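(* Let $s,t\geq 1$ be integers and let $p,q,l$ be three distinct primes with $p,q$ odd, $p\equiv 3 \pmod 4$, $\mathrm{ord}_{p^s}(l)=\phi(p^s)/2$, $\mathrm{ord}_{q^t}(l)=\phi(q^t)$ and $\gcd(\phi(p^s),\phi(q^t))=2$. Let $0\leq i\leq s-1$ and $0\leq j\leq t-1$. Then in the ring $\mathbb{F}_l[x]/\langle x^{p^sq^t}-1\rangle$: (i) If $q$ is a quadratic residue modulo $p$, then \[ \begin{aligned}(\chi_{ij}^* )^2=&\frac{p-3}{4}p^{s-i-1}\Big((q-2)q^{t-j-1}\chi_{ij}^*+\phi(q^{t-j})\sum_{j<m\leq t}\chi_{im}^*\Big)\\&+\frac{p+1}{4}p^{s-i-1}\Big((q-2)q^{t-j-1}\chi_{ij}+\phi(q^{t-j})\sum_{j<m\leq t}\chi_{im}\Big). \end{aligned}\] (ii) If $q$ is a quadratic nonresidue modulo $p$, then \[ \begin{aligned}(\chi_{ij}^* )^2=&\frac{p-3}{4}p^{s-i-1}\Big((q-2)q^{t-j-1}\chi_{ij}^*+\phi(q^{t-j})\Big(\sum_{\substack{j<m\leq t\\2\nmid m-j}}\chi_{im}+\sum_{\substack{j<m\leq t\\2\mid m-j}}\chi_{im}^*\Big)\Big)\\ &+\frac{p+1}{4}p^{s-i-1}\Big((q-2)q^{t-j-1}\chi_{ij}+\phi(q^{t-j})\Big(\sum_{\substack{j<m\leq t\\2\nmid m-j}}\chi_{im}^*+\sum_{\substack{j<m\leq t\\2\mid m-j}}\chi_{im}\Big)\Big). \e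nd{aligned}\]
   Context: Here $\phi$ is Euler's phi function (with $\phi(1)=1$) and $\mathrm{ord}_m(k)$ is the multiplicative order of $k$ modulo $m$. Put $n=p^sq^t$. Fix an integer $g$ that is a primitive root both modulo $p^s$ and modulo $q^t$. For an integer $\gamma$, $C_\gamma=\{\gamma l^r \bmod n: r\geq 0\}\subseteq \mathbb{Z}_n$ is the $l$-cyclotomic coset modulo $n$ containing $\gamma$. For $0\leq i\leq s$, $0\leq j\leq t$ set $C_{ij}=C_{p^iq^j}$ and $C_{ij}^*=C_{p^iq^jg}$; in particular $C_{sj}=C_{sj}^*$ and $C_{st}=C_0=\{0\}$. Define elements of $\mathbb{F}_l[x]/\langle x^{n}-1\rangle$ by $\chi_{ij}=\sum_{\alpha\in C_{ij}}x^\alpha$ and $\chi_{ij}^*=\sum_{\alpha\in C_{ij}^*}x^\alpha$; in particular $\chi_{sj}=\chi_{sj}^*$ and $\chi_{st}=1$. Integer coefficients are read in $\mathbb{F}_l$, and empty sums are $0$. *)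

(* Defs.v *)
From mathcomp Require Import all_boot all_order all_algebra.

Set Implicit Arguments.
Unset Strict Implicit.
Unset Printing Implicit Defensive.

Import GRing.Theory.
Local Open Scope ring_scope.

(* In the ring 'Z_m, d.-primitive_root x says that d is the least positive
   exponent with x ^+ d = 1.  The order is a relation because it is defined
   only for k coprime to m; 'Z_m is the ring of integers mod m for m > 1. *)
Definition has_mult_order (m : nat) (k : int) (d : nat) : Prop :=
  d.-primitive_root (k%:~R : 'Z_m).

Definition primitive_root_mod (m : nat) (g : int) : Prop :=
  has_mult_order m g (totient m).

Definition quad_residue (p a : nat) : Prop :=
  coprime a p /\ exists x : nat, (x ^ 2 = a %[mod p])%N.

Definition quad_nonresidue (p a : nat) : Prop :=
  coprime a p /\ ~ exists x : nat, (x ^ 2 = a %[mod p])%N.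

(* The forward orbit of gamma under multiplication by l; see
   cyclotomic_cosetP. *)
Definition cyclotomic_coset (n l : nat) (gamma : int) : {set 'Z_n} :=
  [set a : 'Z_n | fconnect (fun b : 'Z_n => b * l%:R) gamma%:~R a].

Lemma cyclotomic_cosetP (n l : nat) (gamma : int) (a : 'Z_n) :
  reflect (exists r : nat, a = gamma%:~R * l%:R ^+ r)
          (a \in cyclotomic_coset n l gamma).
Proof.
have iterE r (b : 'Z_n) : iter r (fun c => c * l%:R) b = b * l%:R ^+ r.
  by elim: r => [|r IHr] /=; rewrite ?expr0 ?mulr1 // IHr exprSr mulrA.
rewrite inE; apply: (iffP idP) => [/iter_findex <-|[r ->]].
  by rewrite iterE; eexists.
by rewrite -iterE fconnect_iter.
Qed.

(* The quotient {poly %/ h} silently becomes {poly %/ 'X} unless h is monic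
   of size > 1; mk_monic_XnsubOne shows this does not happen for n > 0. *)
Notation cyclic_ring l n := {poly %/ ('X^n - 1 : {poly 'F_l})}.

Lemma mk_monic_XnsubOne (l n : nat) :
  (0 < n)%N -> mk_monic ('X^n - 1 : {poly 'F_l}) = 'X^n - 1.
Proof.
move=> n_gt0; rewrite /mk_monic -[1]/(1%:P) size_XnsubC // ltnS n_gt0 /=.
by rewrite monicXnsubC.
Qed.

Definition coset_sum (l n : nat) (gamma : int) : cyclic_ring l n :=
  \sum_(a in cyclotomic_coset n l gamma) 'qX ^+ (a : nat).

Definition chi (l p q s t i j : nat) : cyclic_ring l (p ^ s * q ^ t) :=
  coset_sum l (p ^ s * q ^ t) (p ^ i * q ^ j)%N%:Z.

Definition chi_star (l p q s t : nat) (g : int) (i j : nat) :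
    cyclic_ring l (p ^ s * q ^ t) :=
  coset_sum l (p ^ s * q ^ t) ((p ^ i * q ^ j)%N%:Z * g).

(* Main.v *)
(* Write x for the class of X and put y = x ^ (q ^ t), z = x ^ (p ^ s); every
   power of x is uniquely y ^ u * z ^ v.  Counting shows that the powers of l
   are exactly the units mod n that are squares mod p, so each of the cosets
   C_ij, C_ij^* is the set of p ^ i * q ^ j * W with W a unit of prescribed
   quadratic character mod p.  Hence its sum factors as Y * B_j, where Y is the
   sum of the powers of y ^ (p ^ i) with exponents u of a fixed quadratic
   character and B_j the sum of the powers of z ^ (q ^ j) with exponents prime
   to q.  The character of u differs from that of W by the character of
   q ^ (t - j), which is why the parity of m - j enters for q a nonresidue.
   Since p = 3 mod 4, the squares mod p form the Paley difference set, which
   gives Y ^ 2; and B_j is a difference of two geometric sums, which gives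
   B_j ^ 2. *)
Require Import Defs.
From mathcomp Require Import all_boot all_order all_algebra.
From mathcomp Require Import zify ring.

Set Implicit Arguments.
Unset Strict Implicit.
Unset Printing Implicit Defensive.

Import GRing.Theory.
Local Open Scope ring_scope.

(* By Euler's criterion, [b = false] gives the nonzero squares and [b = true]
   the nonsquares. *)
Definition legendre_class (p : nat) (b : bool) : {set 'F_p} :=
  [set c : 'F_p | c ^+ p.-1./2 == (-1) ^+ b].

(** * The Paley difference set *)

Section PaleyDifferenceSet.

Variable p : nat.
Hypotheses (p_prime : prime p) (p_mod4 : (p %% 4 = 3)%N).

Local Notation S := (legendre_class p).

Lemma legendre_classM b b' c d :
  c \in S b -> d \in S b' -> c * d \in S (b (+) b').
Proof.
by rewrite !inE exprMn => /eqP-> /eqP->; rewrite signr_addb.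
Qed.

(** Fermat's little theorem: the Frobenius map fixes the images of the naturals, which are all of
    ['F_p]. *)
Lemma Fp_expr_pred (c : 'F_p) : c != 0 -> c ^+ p.-1 = 1.
Proof.
move=> c0; apply: (mulfI c0); rewrite -exprS mulr1.
rewrite prednK ?prime_gt0 // -(pFrobenius_autE (pchar_Fp p_prime)).
by rewrite -[c]natr_Zp pFrobenius_aut_nat.
Qed.

Lemma legendre_class_ex c : c != 0 -> exists b, c \in S b.
Proof.
move=> c0; have: (c ^+ p.-1./2) ^+ 2 = 1.
  by rewrite -exprM muln2 (_ : (_./2).*2 = p.-1)%N ?Fp_expr_pred //; lia.
move/eqP; rewrite sqrf_eq1 => /orP[] h; [exists false | exists true];
  by rewrite inE.
Qed.

Lemma Fp_oppr1_neq1 : (-1 : 'F_p) != 1.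
Proof.
rewrite eq_sym -subr_eq0 opprK -[1 + 1]/(2%:R) -(dvdn_pcharf (pchar_Fp p_prime)).
by rewrite gtnNdvd //; lia.
Qed.

Lemma legendre_class_inj b b' c : c \in S b -> c \in S b' -> b = b'.
Proof.
rewrite !inE => /eqP->; case: b b' => [] [] //; rewrite expr0 expr1.
  by rewrite (negPf Fp_oppr1_neq1).
by rewrite eq_sym (negPf Fp_oppr1_neq1).
Qed.

Lemma legendre_class0 b : 0 \notin S b.
Proof.
by rewrite inE expr0n (_ : (p.-1./2 == 0) = false)%N; [rewrite eq_sym signr_eq0 | lia].
Qed.

(** For [p = 3] mod 4 the exponent [(p - 1) / 2] is odd. Hence negation swaps the two classes, which
    the counting below relies on. *)
Lemma legendre_classN1 : -1 \in S true.
Proof.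
have odd_h : odd p.-1./2 by lia.
by rewrite inE -(signr_odd _ p.-1./2) odd_h.
Qed.

Lemma legendre_classN b c : (- c \in S b) = (c \in S (~~ b)).
Proof.
have N d b' : d \in S b' -> - d \in S (~~ b').
  by move=> dS; rewrite -mulN1r -addTb legendre_classM // legendre_classN1.
by apply/idP/idP => /N; rewrite ?opprK ?negbK.
Qed.

(** The two classes partition the [p - 1] nonzero elements, and negation is a bijection between
    them. *)
Lemma card_legendre_class b : #|S b| = p.-1./2.
Proof.
have E b' : #|S (~~ b')| = #|S b'|.
  rewrite -(card_imset (S b') (@oppr_inj 'F_p)); apply: eq_card => c.
  apply/idP/imsetP => [cS|[d dS ->]]; last by rewrite legendre_classN negbK.
  by exists (- c); rewrite ?opprK // legendre_classN.
have D : [set~ (0 : 'F_p)] = S b :|: S (~~ b).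
  apply/setP=> c; rewrite in_setC1 in_setU.
  have [->|/legendre_class_ex[b' cS]] := eqVneq c 0.
    by rewrite !(negPf (legendre_class0 _)).
  by case: b b' cS => [] [] /= ->; rewrite ?orbT.
have I : [disjoint S b & S (~~ b)].
  rewrite disjoint_subset; apply/subsetP=> c cS; rewrite !inE.
  apply/negP=> cS'; have := @legendre_class_inj b (~~ b) c cS.
  by rewrite inE cS' => /(_ isT); case: (b).
have := cardsC1 (0 : 'F_p); rewrite D cardsU (disjoint_setI0 I) cards0 subn0 E.
by rewrite card_Fp // => <-; rewrite addnn doubleK.
Qed.

Definition residue_difference_count (c : 'F_p) : nat :=
  #|[set rs in setX (S false) (S false) | rs.1 - rs.2 == c]|.

Local Notation lam := residue_difference_count.

(** Scaling by a square injects the representations of [c] as a difference into those of [u * c];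
    the inverse of [u] is again a square and gives the other inequality. *)
Lemma residue_difference_countM u c : u \in S false -> lam (u * c) = lam c.
Proof.
move=> uS; have u0 : u != 0 by apply: contraTneq uS => ->; apply: legendre_class0.
have H v d : v \in S false -> (lam d <= lam (v * d)%R)%N.
  move=> vS.
  have v0 : v != 0 by apply: contraTneq vS => ->; apply: legendre_class0.
  have inj : injective (fun rs : 'F_p * 'F_p => (v * rs.1, v * rs.2)).
    by move=> [a b] [a' b'] /= /eqP; rewrite xpair_eqE => /andP[/eqP e1 /eqP e2];
       rewrite (mulfI v0 e1) (mulfI v0 e2).
  rewrite /lam -(card_imset _ inj); apply/subset_leq_card/subsetP=> z.
  case/imsetP=> -[r s]; rewrite in_set in_setX => /andP[/andP[/= rS sS] /eqP<-] ->.
  by rewrite in_set in_setX /= mulrBr eqxx andbT; apply/andP; split;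
     rewrite -[false]/(false (+) false) legendre_classM.
apply/eqP; rewrite eqn_leq H // andbT -[in leqRHS](mulKf u0 c).
apply: H; rewrite inE exprVn; move: uS; rewrite inE => /eqP->.
by rewrite expr0 invr1.
Qed.

Lemma residue_difference_countN c : lam (- c) = lam c.
Proof.
have H d : (lam d <= lam (- d)%R)%N.
  have inj : injective (fun rs : 'F_p * 'F_p => (rs.2, rs.1)).
    by move=> [a b] [a' b'] [-> ->].
  rewrite /lam -(card_imset _ inj); apply/subset_leq_card/subsetP=> z.
  case/imsetP=> -[r s]; rewrite in_set in_setX => /andP[/andP[/= rS sS] /eqP<-] ->.
  by rewrite in_set in_setX /= opprB eqxx rS sS.
by apply/eqP; rewrite eqn_leq H -{2}[c]opprK H.
Qed.

(* The nonzero elements are [S false] and its opposite, as -1 is a nonsquare. *)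
Lemma residue_difference_count_const c : c != 0 -> lam c = lam 1.
Proof.
case/legendre_class_ex=> -[cS|cS]; last by rewrite -[c]mulr1 residue_difference_countM.
rewrite -residue_difference_countN -[- c]mulr1.
by rewrite residue_difference_countM // legendre_classN.
Qed.

Lemma residue_difference_count0 : lam 0 = p.-1./2.
Proof.
have inj : injective (fun r : 'F_p => (r, r)) by move=> a b [].
rewrite -(card_legendre_class false) -(card_imset _ inj); apply: eq_card=> -[r s].
rewrite in_set in_setX /= subr_eq0; apply/idP/imsetP=> [/andP[/andP[rS _] /eqP<-]|].
  by exists r.
by case=> x xS [-> ->]; rewrite xS eqxx.
Qed.

Lemma sum_residue_difference_count : (\sum_c lam c = p.-1./2 * p.-1./2)%N.
Proof.
rewrite -{1}(card_legendre_class false) -(card_legendre_class false) -cardsX.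
rewrite -sum1_card (partition_big (fun rs => rs.1 - rs.2) predT) //=.
by apply: eq_bigr => c _; rewrite sum1dep_card.
Qed.

(** Count all pairs of squares by their difference: with [h = (p - 1) / 2], the difference 0 occurs
    [h] times and each of the other [2h] differences equally often, so [h ^ 2 = h + 2h * lam 1].
    With [p = 4k + 3] this gives [lam 1 = k]. *)
Lemma residue_difference_count_eq c : c != 0 -> lam c = ((p - 3) %/ 4)%N.
Proof.
move=> /residue_difference_count_const->.
have := sum_residue_difference_count.
rewrite (bigD1 0) //= residue_difference_count0.
rewrite (eq_bigr (fun=> lam 1)) => [|d]; last exact: residue_difference_count_const.
rewrite sum_nat_const (_ : #|_| = p.-1); last first.
  rewrite -[in RHS](card_Fp p_prime) -(cardsC1 (0 : 'F_p)).
  by apply: eq_card=> d; rewrite !inE.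
set k := ((p - 3) %/ 4)%N; have -> : (p.-1./2 = 2 * k + 1)%N by lia.
have -> : (p.-1 = 2 * (2 * k + 1))%N by lia.
nia.
Qed.

(* The factor [h] makes [e] multiplicative when [e c] is only a power [w ^+ c]
   with [w ^+ p * h = h], although [w ^+ p] need not be 1. *)
Variables (R : comNzRingType) (e : 'F_p -> R) (h : R).
Hypothesis eD : forall c d, e c * e d * h = e (c + d) * h.

Local Notation T b := (\sum_(c in S b) e c).

Lemma sum_Fp_split (F : 'F_p -> R) b :
  \sum_c F c = F 0 + (\sum_(c in S b) F c + \sum_(c in S (~~ b)) F c).
Proof.
rewrite (bigD1 0) //= (bigID (mem (S b))) /=; congr (_ + (_ + _)).
  apply: eq_bigl => c; case: eqP => // ->; by rewrite (negPf (legendre_class0 _)).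
apply: eq_bigl => c; have [->|/legendre_class_ex[b' cS]] := eqVneq c 0.
  by rewrite !(negPf (legendre_class0 _)).
apply/idP/idP => [cN|cS2]; first by case: b b' cS cN => [] [] //= ->.
by apply/negP=> cS1; have := legendre_class_inj cS1 cS2; case: (b).
Qed.

(** The nonsquares are the negatives of the squares, so the product is a sum of [e (r - s)] over
    pairs of squares; collecting terms by [r - s] brings in the counts [lam]. *)
Lemma residue_sumM_nonresidue_sum :
  T false * T true * h
  = ((p.-1./2)%:R * e 0 + ((p - 3) %/ 4)%:R * (T false + T true)) * h.
Proof.
have -> : T false * T true * h
        = \sum_(rs in setX (S false) (S false)) e (rs.1 - rs.2) * h.
  rewrite [in X in _ * X * _](reindex_inj oppr_inj) /= !mulr_suml.
  rewrite (eq_bigl (fun rs => (rs.1 \in S false) && (rs.2 \in S false))); last first.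
    by move=> [r s]; rewrite in_setX.
  rewrite -(pair_big (mem (S false)) (mem (S false)) (fun r s => e (r - s) * h)) /=.
  apply: eq_bigr => r _; rewrite mulr_sumr mulr_suml; apply: eq_big => s.
    by rewrite legendre_classN.
  by rewrite eD.
rewrite (partition_big (fun rs => rs.1 - rs.2) predT) //=.
rewrite (eq_bigr (fun c => (lam c)%:R * e c * h)) => [|c _]; last first.
  rewrite -mulrA mulr_natl -sumr_const.
  apply: eq_big => [rs|rs /andP[_ /eqP->]] //.
  by rewrite !inE.
rewrite (sum_Fp_split _ false) residue_difference_count0 mulrDl; congr (_ + _).
rewrite -mulrA mulrDl mulrDr !mulr_suml !mulr_sumr; congr (_ + _);
  apply: eq_bigr => c cS; rewrite residue_difference_count_eq ?mulrA //;
  by apply: contraTneq cS => ->; apply: legendre_class0.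
Qed.

(** The square is recovered from the mixed product: [T b] equals the full sum minus [e 0] minus
    [T (~~ b)]. Up to [h], the full sum is invariant under translation, so multiplying it by [T b]
    only scales it by the size of the class, and [e 0] acts as 1. *)
Lemma legendre_class_sum_square b :
  T b * T b * h
  = (((p - 3) %/ 4)%:R * T b + ((p + 1) %/ 4)%:R * T (~~ b)) * h.
Proof.
have A : T b * (\sum_c e c) * h = (p.-1./2)%:R * (\sum_c e c) * h.
  rewrite !mulr_suml -(card_legendre_class b) -[_ * h in RHS]mulrA mulr_natl -sumr_const.
  apply: eq_bigr => c _; rewrite mulr_sumr !mulr_suml [in RHS](reindex_inj (addrI c)) /=.
  by apply: eq_bigr => d _; rewrite eD.
have Z : T b * e 0 * h = T b * h.
  by rewrite !mulr_suml; apply: eq_bigr => c _; rewrite eD addr0.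
have P : T b * T (~~ b) * h
       = ((p.-1./2)%:R * e 0 + ((p - 3) %/ 4)%:R * (T b + T (~~ b))) * h.
  case: (b) => /=; last exact: residue_sumM_nonresidue_sum.
  by rewrite [T true * T false]mulrC residue_sumM_nonresidue_sum [T true + _]addrC.
rewrite (sum_Fp_split _ b) in A.
have -> : T b * T b * h
   = T b * (e 0 + (T b + T (~~ b))) * h - T b * e 0 * h - T b * T (~~ b) * h by ring.
rewrite A Z P.
(* With [k = (p - 3) / 4] the terms in [e 0] cancel, and the coefficients of [T b] and [T (~~ b)]
   become [(2k + 1) - 1 - k = k] and [(2k + 1) - k = k + 1]. *)
have -> : ((p + 1) %/ 4 = ((p - 3) %/ 4) + 1)%N by lia.
have -> : (p.-1./2 = 2 * ((p - 3) %/ 4) + 1)%N by lia.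
rewrite !natrD; ring.
Qed.

End PaleyDifferenceSet.

(** * Sums of powers of an element of finite order *)

Section PowerSums.

Variable R : comNzRingType.
Implicit Types (w : R) (n k m : nat).

Lemma sum_nat_blocks (F : nat -> R) n k :
  \sum_(0 <= u < n * k) F u = \sum_(0 <= i < n) \sum_(0 <= r < k) F (r + i * k)%N.
Proof.
rewrite big_nat_mul; apply: eq_bigr => i _.
by rewrite -{1}[(i * k)%N]add0n big_addn mulSn addnK.
Qed.

(** Multiplication by [w] shifts the exponents cyclically. *)
Lemma mul_geom_sum w n k :
  w ^+ n = 1 -> w ^+ k * \sum_(0 <= i < n) w ^+ i = \sum_(0 <= i < n) w ^+ i.
Proof.
move=> wn1; elim: k => [|k IHk]; rewrite ?expr0 ?mul1r // exprS -mulrA IHk.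
case: n wn1 {IHk} => [|n] wn1; first by rewrite big_nil mulr0.
rewrite mulr_sumr big_nat_recr //= [in RHS]big_nat_recl //= addrC -exprS wn1 expr0.
by congr (_ + _); apply: eq_bigr => i _; rewrite -exprS.
Qed.

Lemma geom_sum_mul w n k a :
  w ^+ n = 1 ->
  (\sum_(0 <= i < k) w ^+ (a * i)) * \sum_(0 <= i < n) w ^+ i
  = k%:R * \sum_(0 <= i < n) w ^+ i.
Proof.
move=> wn1; rewrite mulr_suml (eq_bigr (fun=> \sum_(0 <= i < n) w ^+ i)).
  by rewrite sumr_const_nat subn0 mulr_natl.
by move=> i _; rewrite mul_geom_sum.
Qed.

Definition legendre_sum p b w k : R :=
  \sum_(0 <= u < p ^ k | (u%:R : 'F_p) \in legendre_class p b) w ^+ u.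

(** For [k = 0] the only index is 0 and [coprime 0 1] holds, so the sum is 1. This is the factor
    needed for the cosets with [j = t]. *)
Definition coprime_sum q w k : R :=
  \sum_(0 <= v < q ^ k | coprime v (q ^ k)) w ^+ v.

(** Writing [u = r + k * p] with [r < p] splits off the factor [h], the geometric sum of [w ^+ p],
    because the quadratic character sees only [r]. Then [h * h = p ^ m * h], and the Paley identity
    applies to the remaining factor. *)
Lemma legendre_sum_square p b w m :
  prime p -> (p %% 4 = 3)%N -> w ^+ (p ^ m.+1) = 1 ->
  legendre_sum p b w m.+1 ^+ 2
  = (p ^ m)%:R * (((p - 3) %/ 4)%:R * legendre_sum p b w m.+1
                  + ((p + 1) %/ 4)%:R * legendre_sum p (~~ b) w m.+1).
Proof.
move=> p_prime p_mod4 w1; pose h := \sum_(0 <= k < p ^ m) (w ^+ p) ^+ k.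
pose e (c : 'F_p) := w ^+ (c : nat).
have wp1 : (w ^+ p) ^+ (p ^ m) = 1 by rewrite -exprM -expnS.
have hh : h * h = (p ^ m)%:R * h.
  have := @geom_sum_mul (w ^+ p) (p ^ m) (p ^ m) 1 wp1.
  by under eq_bigr do rewrite mul1n.
(* Reducing [c + d] mod [p] changes the exponent by a multiple of [p], which [h] absorbs. *)
have eD c d : e c * e d * h = e (c + d) * h.
  have cdE : (c + d)%R = (((c : nat) + d) %% p)%N :> nat.
    transitivity (modn ((c : nat) + d) (Zp_trunc (pdiv p)).+2) => //.
    by congr modn; apply: Fp_cast.
  rewrite /e -exprD cdE {1}(divn_eq ((c : nat) + d)%N p) exprD mulrAC mulrC.
  by rewrite [(_ * p)%N]mulnC exprM mul_geom_sum.
have LE b' : legendre_sum p b' w m.+1 = (\sum_(c in legendre_class p b') e c) * h.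
  pose F r := if (r%:R : 'F_p) \in legendre_class p b' then w ^+ r else 0.
  have -> : \sum_(c in legendre_class p b') e c = \sum_(0 <= r < p) F r.
    rewrite -[X in index_iota 0 X](Fp_cast p_prime) big_mkord big_mkcond.
    by apply: eq_bigr => c _; rewrite /F natr_Zp.
  rewrite /legendre_sum big_mkcond expnSr sum_nat_blocks mulr_sumr.
  apply: eq_bigr => k _; rewrite mulr_suml; apply: eq_bigr => r _.
  rewrite natrD natrM pchar_Fp_0 // mulr0 addr0 /F; case: ifP; rewrite ?mul0r //.
  by rewrite exprD mulnC exprM.
rewrite !LE expr2 mulrACA hh [in RHS]mulrA.
have P := legendre_class_sum_square p_prime p_mod4 eD b.
transitivity ((p ^ m)%:R * ((\sum_(c in legendre_class p b) e c)
  * (\sum_(c in legendre_class p b) e c) * h)); first by ring.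
by rewrite P; ring.
Qed.

(** The exponents not prime to [q] are its multiples: in each block of length [q] only the first
    entry is one. *)
Lemma coprime_sum_diff q w m : prime q ->
  coprime_sum q w m.+1
  = \sum_(0 <= v < q ^ m.+1) w ^+ v - \sum_(0 <= v < q ^ m) (w ^+ q) ^+ v.
Proof.
move=> q_prime; apply/eqP; rewrite eq_sym subr_eq; apply/eqP.
rewrite (bigID (fun v => coprime v (q ^ m.+1))) /=; congr (_ + _).
rewrite big_mkcond expnSr sum_nat_blocks; apply: eq_bigr => k _.
rewrite big_ltn ?prime_gt0 // add0n big_nat_cond big1 => [|r].
  by rewrite addr0 -expnSr coprime_pexpr // coprimeMl {2}/coprime gcdnn
             gtn_eqF ?prime_gt1 // andbF /= mulnC exprM.
rewrite andbT => /andP[r_gt0 r_lt].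
by rewrite -expnSr coprime_pexpr // coprime_sym prime_coprime // dvdn_addl ?dvdn_mull //
           gtnNdvd.
Qed.

(** With [a] the full sum and [h] the sum over multiples of [q], each absorbs powers:
    [a ^ 2 = q ^ (m + 1) a], [h a = q ^ m a], [h ^ 2 = q ^ m h]. So [(a - h) ^ 2 = q ^ m ((q - 2)(a
    - h) + (q - 1) h)]. *)
Lemma coprime_sum_square q w m :
  prime q -> w ^+ (q ^ m.+1) = 1 ->
  coprime_sum q w m.+1 ^+ 2
  = (q ^ m)%:R * ((q - 2)%:R * coprime_sum q w m.+1
                  + (q.-1)%:R * \sum_(0 <= v < q ^ m) (w ^+ q) ^+ v).
Proof.
move=> q_prime w1; rewrite coprime_sum_diff //.
set a := \sum_(0 <= v < _) _; set h := \sum_(0 <= v < q ^ m) _.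
have wq1 : (w ^+ q) ^+ (q ^ m) = 1 by rewrite -exprM -expnS.
have aa : a * a = (q ^ m)%:R * q%:R * a.
  rewrite -natrM -expnSr -(geom_sum_mul (q ^ m.+1) 1 w1).
  by under eq_bigr do rewrite mul1n.
have ha : h * a = (q ^ m)%:R * a.
  rewrite -(geom_sum_mul (q ^ m) q w1); congr (_ * _).
  by apply: eq_bigr => i _; rewrite exprM.
have hh : h * h = (q ^ m)%:R * h.
  rewrite -(geom_sum_mul (q ^ m) 1 wq1).
  by under eq_bigr do rewrite mul1n.
have q2 : (2 <= q)%N by apply: prime_gt1.
rewrite -subn1 !natrB ?(ltnW q2) //.
transitivity (a * a - (h * a) *+ 2 + h * h); first by ring.
by rewrite aa ha hh; ring.
Qed.

(** For [m < t] the summand is [a m - a m.+1], where [a m] is the full geometric sum of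
    [w ^+ (q ^ m)]; the summand at [m = t] is [1 = a t]. This turns the geometric sum in the square
    of a coprime sum into the sum over [m > j] of the theorem. *)
Lemma coprime_sum_telescope q w t j : prime q -> (j < t)%N ->
  \sum_(j.+1 <= m < t.+1) coprime_sum q (w ^+ (q ^ m)) (t - m)
  = \sum_(0 <= v < q ^ (t - j).-1) ((w ^+ (q ^ j)) ^+ q) ^+ v.
Proof.
move=> q_prime lt_jt; rewrite big_nat_recr //= subnn.
pose a m : R := \sum_(0 <= v < q ^ (t - m)) (w ^+ (q ^ m)) ^+ v.
rewrite (eq_big_nat _ _ (F2 := fun m => - (a m.+1 - a m))) => [|m /andP[_ lt_mt]].
  rewrite sumrN telescope_sumr // opprB /coprime_sum expn0 big_mkcond !big_nat1 /=.
  by rewrite {2}/a subnn expn0 big_nat1 subrK /a -exprM -expnSr subnS.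
rewrite opprB /a subnS; case: (t - m)%N (subn_gt0 m t) => [|k _]; first by rewrite lt_mt.
by rewrite coprime_sum_diff // -exprM -expnSr.
Qed.

End PowerSums.

(** * Residues modulo n, units of given quadratic character, Chinese remainders *)

Lemma Zp_nat_eqE n a b : (1 < n)%N ->
  (a%:R == b%:R :> 'Z_n) = (a == b %[mod n])%N.
Proof. by move=> n_gt1; rewrite -val_eqE /= !val_Zp_nat. Qed.

Lemma eq_modn_dvd m n a b : (m %| n)%N -> (a = b %[mod n] -> a = b %[mod m])%N.
Proof. by move=> mn ab; rewrite -(modn_dvdm a mn) ab modn_dvdm. Qed.

Lemma Zp_nat_dvd m n a b : (1 < m)%N -> (1 < n)%N -> (m %| n)%N ->
  a%:R = b%:R :> 'Z_n -> a%:R = b%:R :> 'Z_m.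
Proof.
move=> m_gt1 n_gt1 mn /eqP; rewrite Zp_nat_eqE // => /eqP/(eq_modn_dvd mn) abm.
by apply/eqP; rewrite Zp_nat_eqE // abm.
Qed.

Lemma Fp_nat_mod p n a : prime p -> (p %| n)%N -> (a %% n)%:R = a%:R :> 'F_p.
Proof.
move=> p_prime pn; have Cp := pchar_Fp p_prime.
by rewrite -(GRing.natr_mod_pchar Cp) modn_dvdm // GRing.natr_mod_pchar.
Qed.

Lemma Fp_nat_eq_mod p n a b : prime p -> (p %| n)%N ->
  (a = b %[mod n])%N -> a%:R = b%:R :> 'F_p.
Proof.
by move=> p_prime pn abn; rewrite -(Fp_nat_mod a p_prime pn) abn Fp_nat_mod.
Qed.

Lemma Fp_nat_neq0 p a : prime p -> (a%:R != 0 :> 'F_p) = coprime p a.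
Proof.
by move=> p_prime; rewrite prime_coprime // (dvdn_pcharf (pchar_Fp p_prime)).
Qed.

Lemma legendre_classX p (p_prime : prime p) c b k :
  c \in legendre_class p b -> c ^+ k \in legendre_class p (b && odd k).
Proof.
move=> cS; elim: k => [|k IHk].
  by rewrite expr0 inE expr1n andbF expr0.
have := legendre_classM cS IHk; rewrite -exprS.
by congr (_ \in legendre_class p _) => /=; case: b {cS IHk}; case: odd.
Qed.

Lemma legendre_class_divl p (p_prime : prime p) (p_mod4 : (p %% 4 = 3)%N) b b' c d :
  c * d \in legendre_class p b -> d \in legendre_class p b' ->
  c \in legendre_class p (b (+) b').
Proof.
move=> cdS dS; have c0 : c != 0.
  by apply: contraTneq cdS => ->; rewrite mul0r legendre_class0.
have [b2 cS] := legendre_class_ex p_prime p_mod4 c0.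
have := legendre_class_inj p_prime p_mod4 cdS (legendre_classM cS dS).
by move=> ->; rewrite -addbA addbb addbF.
Qed.

Definition unit_class p n b : {set 'Z_n} :=
  [set x : 'Z_n | (x \is a GRing.unit) && ((x : nat)%:R \in legendre_class p b)].

Lemma mem_unit_class p n b a : prime p -> (p %| n)%N -> (1 < n)%N ->
  (a%:R \in unit_class p n b)
  = coprime n a && (a%:R \in legendre_class p b).
Proof.
move=> p_prime pn n_gt1; rewrite inE unitZpE // val_Zp_nat //.
by rewrite (Fp_nat_mod a p_prime pn).
Qed.

(** The two classes together are all the units mod [n], and negation exchanges them because -1 is a
    nonsquare mod [p]. *)
Lemma card_unit_class p n b :
  prime p -> (p %% 4 = 3)%N -> (p %| n)%N -> (1 < n)%N ->
  (#|unit_class p n b|.*2 = totient n)%N.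
Proof.
move=> p_prime p_mod4 pn n_gt1; have p_gt1 := prime_gt1 p_prime.
have nat_inv (P : 'Z_n -> Prop) : (forall a : nat, P a%:R) -> forall x, P x.
  by move=> Pn x; rewrite -[x]natr_Zp.
have N b' x : x \in unit_class p n b' -> - x \in unit_class p n (~~ b').
  elim/nat_inv: x => a; rewrite -mulN1r.
  (* A natural representative of -1 that is also -1 in ['F_p], since [p] divides [n]. *)
  have -> : -1 = (n.-1)%:R :> 'Z_n.
    apply/eqP; rewrite eq_sym -subr_eq0 opprK natr1 prednK ?(ltnW n_gt1) //.
    by rewrite pchar_Zp.
  rewrite -natrM !mem_unit_class // => /andP[na aS].
  rewrite coprimeMr na andbT coprimenP ?(ltnW n_gt1) //= natrM -addTb.
  apply: legendre_classM => //.
  have -> : (n.-1)%:R = -1 :> 'F_p.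
    apply/eqP; rewrite -subr_eq0 opprK natr1 prednK ?(ltnW n_gt1) //.
    by rewrite -(dvdn_pcharf (pchar_Fp p_prime)).
  exact: legendre_classN1.
have E : #|unit_class p n (~~ b)| = #|unit_class p n b|.
  rewrite -(card_imset (unit_class p n b) (@oppr_inj 'Z_n)); apply: eq_card => x.
  apply/idP/imsetP => [xS|[y yS ->]]; last exact: N.
  by exists (- x); rewrite ?opprK // -[b]negbK N.
have I : unit_class p n b :&: unit_class p n (~~ b) = set0.
  apply/setP=> x; rewrite inE [RHS]inE; apply/negP=> /andP[].
  rewrite 1!inE => /andP[_ xS]; rewrite 1!inE => /andP[_ xS'].
  by have := legendre_class_inj p_prime p_mod4 xS xS'; case: (b).
have U : #|unit_class p n b :|: unit_class p n (~~ b)| = totient n.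
  rewrite -(card_units_Zp (ltnW n_gt1)) cardsT card_sub.
  apply: eq_card => x; elim/nat_inv: x => a.
  rewrite inE !mem_unit_class // -andb_orr [RHS]inE unitZpE //.
  have [na|//] := boolP (coprime n a).
  have : (a%:R : 'F_p) != 0 by rewrite Fp_nat_neq0 // (coprime_dvdl pn).
  case/(legendre_class_ex p_prime p_mod4)=> b' aS.
  by case: b b' aS {E I} => [] [] /= ->; rewrite ?orbT.
by have := cardsUI (unit_class p n b) (unit_class p n (~~ b));
  rewrite I cards0 addn0 U E addnn => ->.
Qed.

(** If [z] were a square mod [p], all [totient m] distinct powers of [z] would lie in a class
    holding only half of the units. Applied to [g], this makes it a nonsquare. *)
Lemma prim_root_unit_class m z p b :
  prime p -> (p %% 4 = 3)%N -> (p %| m)%N -> (1 < m)%N ->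
  coprime m z -> (totient m).-primitive_root (z%:R : 'Z_m) ->
  z%:R \in legendre_class p b -> b = true.
Proof.
move=> p_prime p_mod4 pm m_gt1 mz prim_z; case: b => // zS.
have inj : injective (fun r : 'I_(totient m) => (z%:R : 'Z_m) ^+ r).
  move=> r r' /eqP; rewrite (eq_prim_root_expr prim_z) !modn_small //.
  by move=> /eqP/val_inj.
have tot_gt0 := prim_order_gt0 prim_z.
have : (#|[set (z%:R : 'Z_m) ^+ r | r : 'I_(totient m)]| <= #|unit_class p m false|)%N.
  apply/subset_leq_card/subsetP=> _ /imsetP[r _ ->].
  rewrite -natrX mem_unit_class // coprimeXr // natrX.
  exact: (legendre_classX p_prime r zS).
rewrite card_imset // card_ord.
have := card_unit_class false p_prime p_mod4 pm m_gt1; lia.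
Qed.

Lemma prime_power_gt1 p k : prime p -> (0 < k)%N -> (1 < p ^ k)%N.
Proof. by move=> p_prime k_gt0; rewrite -(exp1n k) ltn_exp2r // prime_gt1. Qed.

Lemma distinct_primes_coprime a b : prime a -> prime b -> a <> b -> coprime a b.
Proof. by move=> a_pr b_pr ab; rewrite prime_coprime // dvdn_prime2 //; apply/eqP. Qed.

Lemma eqn_modMr_coprime m k a b : coprime m k ->
  (a * k = b * k %[mod m] -> a = b %[mod m])%N.
Proof.
move=> mk; wlog ab : a b / (a <= b)%N => [wl|].
  by case/orP: (leq_total a b) => ab E; [|symmetry]; apply: wl.
move/eqP; rewrite eq_sym eqn_mod_dvd ?leq_mul2r ?ab ?orbT // -mulnBl Gauss_dvdl //.
by rewrite -eqn_mod_dvd // => /eqP.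
Qed.

Lemma mod_linear_solve P Q w : coprime P Q -> (0 < P)%N ->
  exists2 u, (u < P)%N & (u * Q = w %[mod P])%N.
Proof.
(* The number that is [w] mod [P] and 0 mod [Q] is a multiple of [Q]; its quotient by [Q] solves the
   congruence. *)
move=> PQ P0; have /dvdnP[u uE] : (Q %| chinese P Q w 0)%N.
  by rewrite /dvdn chinese_modr // mod0n.
by exists (u %% P)%N; rewrite ?ltn_mod // modnMml -uE chinese_modl.
Qed.

Lemma crt_pair_inj P Q u u' v v' : coprime P Q ->
  (u < P)%N -> (u' < P)%N -> (v < Q)%N -> (v' < Q)%N ->
  (u * Q + v * P = u' * Q + v' * P %[mod P * Q])%N -> u = u' /\ v = v'.
Proof.
move=> PQ uP uP' vQ vQ' /eqP; rewrite chinese_remainder // => /andP[/eqP EP /eqP].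
rewrite !modnMDl => EQ; move: EP; rewrite ![(_ * Q + _)%N]addnC !modnMDl => EP.
split.
  by have := eqn_modMr_coprime PQ EP; rewrite !modn_small.
by rewrite coprime_sym in PQ; have := eqn_modMr_coprime PQ EQ; rewrite !modn_small.
Qed.

Lemma eqn_modM k m a b : (0 < k)%N ->
  (k * a == k * b %[mod k * m])%N = (a == b %[mod m])%N.
Proof. by move=> k0; rewrite -!muln_modr eqn_pmul2l. Qed.

Lemma eq_modn_coprime m a b : (a = b %[mod m])%N -> coprime a m = coprime b m.
Proof. by move=> ab; rewrite -coprime_modl ab coprime_modl. Qed.

Lemma qpolyX_order l n : (0 < n)%N -> 'qX ^+ n = 1 :> cyclic_ring l n.
Proof.
(* Reduction is modulo [mk_monic h], so the hypothesis on [h] is what makes [h] reduce to 0. *)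
move=> n_gt0; have mod_h (h : {poly 'F_l}) : mk_monic h = h -> in_qpoly h (h + 1) = 1.
  move=> hE; rewrite in_qpolyD in_qpoly1 -[RHS]add0r; congr (_ + _).
  apply/val_inj; rewrite /= hE Pdiv.CommonRing.rmodpp //.
  by rewrite /GRing.comm mulrC.
rewrite /qpolyX -rmorphXn /= -(mod_h _ (mk_monic_XnsubOne l n_gt0)).
by congr in_qpoly; rewrite subrK.
Qed.

(** * Cyclotomic cosets *)

Section CyclotomicCosets.

Variables p q s t l : nat.
Hypotheses (p_prime : prime p) (q_prime : prime q) (l_prime : prime l).
Hypotheses (pq_neq : p <> q) (pl_neq : p <> l) (ql_neq : q <> l).
Hypotheses (p_mod4 : (p %% 4 = 3)%N) (s_gt0 : (0 < s)%N) (t_gt0 : (0 < t)%N).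
Hypothesis ord_l_p : (totient (p ^ s) %/ 2).-primitive_root (l%:R : 'Z_(p ^ s)).
Hypothesis ord_l_q : (totient (q ^ t)).-primitive_root (l%:R : 'Z_(q ^ t)).
Hypothesis gcd_phi : gcdn (totient (p ^ s)) (totient (q ^ t)) = 2%N.

Local Notation n := (p ^ s * q ^ t)%N.

Let ps_gt1 : (1 < p ^ s)%N. Proof. exact: prime_power_gt1. Qed.

Let qt_gt1 : (1 < q ^ t)%N. Proof. exact: prime_power_gt1. Qed.

Let n_gt1 : (1 < n)%N.
Proof. by apply: leq_trans ps_gt1 _; rewrite leq_pmulr // ltnW. Qed.

Let p_dvd_n : (p %| n)%N.
Proof. by rewrite dvdn_mulr // dvdn_exp. Qed.

Let coprime_pq i j : coprime (p ^ i) (q ^ j).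
Proof. by rewrite coprimeXl // coprimeXr // distinct_primes_coprime. Qed.

Let coprime_n_l : coprime n l.
Proof. by rewrite coprimeMl !coprimeXl // distinct_primes_coprime. Qed.

Let totient_ps : totient (p ^ s) = (p.-1./2 * p ^ s.-1).*2.
Proof.
by rewrite totient_pfactor // doubleMl; congr (_ * _)%N; lia.
Qed.

(** The exponent [totient (p ^ s) / 2] is [(p - 1) / 2 * p ^ (s - 1)]. Were [l] a nonsquare, raising
    it to this exponent would give an odd power of -1 in ['F_p] instead of 1. *)
Lemma l_residue : l%:R \in legendre_class p false.
Proof.
have l0 : (l%:R : 'F_p) != 0 by rewrite Fp_nat_neq0 // distinct_primes_coprime.
have [[] // lS] := legendre_class_ex p_prime p_mod4 l0.
have := prim_expr_order ord_l_p; rewrite totient_ps divn2 doubleK -natrX => /eqP.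
rewrite -[1]/(1%:R) Zp_nat_eqE ?ps_gt1 // => /eqP/(Fp_nat_eq_mod p_prime).
rewrite dvdn_exp // => /(_ isT); rewrite natrX exprM.
move: lS; rewrite inE => /eqP->.
have p_odd : odd p by lia.
rewrite expr1 -signr_odd oddX p_odd orbT expr1 => /eqP.
by rewrite (negPf (Fp_oppr1_neq1 p_prime p_mod4)).
Qed.

(** The orders [d1] mod [p ^ s] and [d2] mod [q ^ t] are coprime, so the [d1 * d2] powers of [l] are
    distinct mod [n]. All lie in this class, whose size is [totient n / 2 = d1 * d2], so they fill
    it. *)
Lemma unit_class_powers x :
  x \in unit_class p n false -> exists r : nat, x = l%:R ^+ r.
Proof.
set d1 := (totient (p ^ s) %/ 2)%N; set d2 := totient (q ^ t).
(* The gcd divides 2, and [d1] is odd because [p = 3] mod 4. *)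
have d12 : coprime d1 d2.
  have odd_d1 : odd d1.
    rewrite /d1 totient_ps divn2 doubleK oddM oddX.
    by apply/andP; split; [lia | apply/orP; right; lia].
  have : (gcdn d1 d2 %| 2)%N.
    rewrite -gcd_phi dvdn_gcd dvdn_gcdr andbT (dvdn_trans (dvdn_gcdl _ _)) //.
    by rewrite /d1 totient_ps divn2 doubleK -muln2 dvdn_mulr.
  rewrite dvdn_divisors // => /=; rewrite !inE => /orP[//|/eqP g2].
  by have := dvdn_gcdl d1 d2; rewrite g2 dvdn2 odd_d1.
pose f (r : 'I_(d1 * d2)) : 'Z_n := l%:R ^+ r.
have f_inj : injective f.
  move=> r r' /eqP; rewrite /f -!natrX => /eqP E; apply/val_inj => /=.
  have n1 := n_gt1.
  have := Zp_nat_dvd ps_gt1 n1 (dvdn_mulr _ (dvdnn _)) E.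
  have := Zp_nat_dvd qt_gt1 n1 (dvdn_mull _ (dvdnn _)) E.
  rewrite !natrX => /eqP Eq /eqP; move: Eq.
  rewrite (eq_prim_root_expr ord_l_p) (eq_prim_root_expr ord_l_q) => E2 E1.
  have : (r == r' %[mod d1 * d2])%N by rewrite chinese_remainder // E1 E2.
  by rewrite !modn_small // => /eqP.
have sub : f @: setT \subset unit_class p n false.
  apply/subsetP=> _ /imsetP[r _ ->].
  rewrite /f -natrX mem_unit_class ?n_gt1 ?p_dvd_n // coprimeXr ?coprime_n_l //.
  by rewrite natrX; exact: (legendre_classX p_prime r l_residue).
have card_le : (#|unit_class p n false| <= #|f @: setT|)%N.
  rewrite card_imset // cardsT card_ord -leq_double.
  rewrite (card_unit_class false p_prime p_mod4 p_dvd_n n_gt1).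
  by rewrite totient_coprime ?coprime_pq // /d1 /d2 totient_ps divn2 doubleK -doubleMl.
have /eqP <- : f @: setT == unit_class p n false by rewrite eqEcard sub.
by case/imsetP=> r _ ->; exists r.
Qed.

(** Multiplying by powers of [l] preserves the character. Conversely [W / G] is a unit that is a
    square mod [p], hence a power of [l]. Taking [G = 1] gives the plain cosets and [G] congruent to
    [g] the starred ones. *)
Lemma mem_cyclotomic_coset (k G : nat) (gamma : int) e a :
  coprime n G -> G%:R \in legendre_class p e ->
  gamma%:~R = (k * G)%:R :> 'Z_n ->
  reflect (exists W : nat, [/\ coprime n W, W%:R \in legendre_class p e
                             & a = (k * W)%:R])
          (a \in cyclotomic_coset n l gamma).
Proof.
move=> nG GS gammaE; have n1 := n_gt1.
apply: (iffP (cyclotomic_cosetP _ _ _)) => [[r ->]|[W [nW WS ->]]].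
  exists (G * l ^ r)%N; split; first by rewrite coprimeMr nG coprimeXr // coprime_n_l.
    rewrite natrM natrX -[e]addbF legendre_classM //.
    exact: (legendre_classX p_prime r l_residue).
  by rewrite gammaE -natrX -natrM mulnA.
have GU : (G%:R : 'Z_n) \is a GRing.unit by rewrite unitZpE.
pose x : 'Z_n := W%:R / G%:R; have xG : x * G%:R = W%:R by rewrite divrK.
have xS : x \in unit_class p n false.
  rewrite inE unitrM unitrV GU unitZpE // nW /= -[false](addbb e).
  apply: legendre_class_divl (GS) => //; rewrite -natrM.
  suff -> : ((x : nat) * G)%:R = W%:R :> 'F_p by [].
  apply: (Fp_nat_eq_mod p_prime p_dvd_n); apply/eqP.
  by rewrite -Zp_nat_eqE // natrM natr_Zp xG.
have [r xE] := unit_class_powers xS.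
by exists r; rewrite gammaE !natrM -xE -xG mulrA mulrAC.
Qed.

Local Notation y := ('qX ^+ (q ^ t) : cyclic_ring l n).
Local Notation z := ('qX ^+ (p ^ s) : cyclic_ring l n).

(** Put [P = p ^ (s - i)], [Q = q ^ (t - j)] and write [W = u * Q + v * P] mod [P * Q]. The
    character of [W] is that of [u * Q], whence the correction by [Q], and [W] is prime to [Q]
    exactly when [v] is. The exponent [p ^ i * q ^ j * W] splits as
    [p ^ i * u * q ^ t + q ^ j * v * p ^ s]. *)
Lemma coset_sum_factor c i j e G gamma :
  q%:R \in legendre_class p c -> (i < s)%N -> (j <= t)%N ->
  coprime n G -> G%:R \in legendre_class p e ->
  gamma%:~R = (p ^ i * q ^ j * G)%:R :> 'Z_n ->
  coset_sum l n gamma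
  = legendre_sum p (e (+) (c && odd (t - j))) (y ^+ (p ^ i)) (s - i)
    * coprime_sum q (z ^+ (q ^ j)) (t - j).
Proof.
move=> qS lt_is le_jt nG GS gammaE; set b := e (+) _.
have n1 := n_gt1.
have memP a := mem_cyclotomic_coset a nG GS gammaE.
set P := (p ^ (s - i))%N; set Q := (q ^ (t - j))%N; set K := (p ^ i * q ^ j)%N.
have psE : (p ^ s = p ^ i * P)%N by rewrite -expnD subnKC // ltnW.
have qtE : (q ^ t = q ^ j * Q)%N by rewrite -expnD subnKC.
have PQ : coprime P Q by exact: coprime_pq.
have nE : n = (K * (P * Q))%N by rewrite psE qtE mulnACA.
have K0 : (0 < K)%N by rewrite muln_gt0 !expn_gt0 !prime_gt0.
have P0 : (0 < P)%N by rewrite expn_gt0 prime_gt0.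
have Q0 : (0 < Q)%N by rewrite expn_gt0 prime_gt0.
have pP : (p %| P)%N by rewrite dvdn_exp // subn_gt0.
have QS : Q%:R \in legendre_class p (c && odd (t - j)).
  by rewrite natrX legendre_classX.
pose f (uv : 'I_P * 'I_Q) : 'Z_n := (K * (uv.1 * Q + uv.2 * P))%:R.
pose D := [set uv : 'I_P * 'I_Q |
  ((uv.1)%:R \in legendre_class p b) && coprime uv.2 Q].
have f_inj : injective f.
  move=> [u v] [u' v'] /eqP; rewrite /f Zp_nat_eqE // [X in _ == _ %[mod X]]nE.
  rewrite eqn_modM // => /eqP /(crt_pair_inj PQ) /= [//|//|//|//|uE vE].
  by congr pair; apply/val_inj.
have f_im : cyclotomic_coset n l gamma = f @: D.
  apply/setP=> a; apply/memP/imsetP=> [[W [nW WS ->]]|[[u v]]].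
    have [u uP uE] := mod_linear_solve W PQ P0.
    have QP : coprime Q P by rewrite coprime_sym.
    have [v vQ vE] := mod_linear_solve W QP Q0.
    exists (Ordinal uP, Ordinal vQ); last first.
      apply/eqP; rewrite /f /= Zp_nat_eqE // [X in _ == _ %[mod X]]nE eqn_modM //.
      rewrite chinese_remainder // modnMDl vE eqxx andbT.
      by rewrite addnC modnMDl uE.
    rewrite inE /=; apply/andP; split.
      apply: legendre_class_divl (QS) => //; rewrite -natrM.
      by rewrite (Fp_nat_eq_mod p_prime pP uE).
    have : coprime (v * P) Q.
      rewrite (eq_modn_coprime vE) coprime_sym; apply: coprime_dvdl nW.
      by rewrite qtE dvdn_mull // dvdn_mull.
    by rewrite coprimeMl => /andP[].
  rewrite inE /= => /andP[uS vQ] ->.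
  (* [v * P + u * Q] itself need not be prime to q when [j = t] *)
  pose W := chinese (p ^ s) (q ^ t) (u * Q) (if t == j then 1 else v * P)%N.
  have pqst : coprime (p ^ s) (q ^ t) by exact: coprime_pq.
  have Wp : (W = u * Q %[mod p ^ s])%N by apply: chinese_modl.
  have Wq := chinese_modr pqst (u * Q) (if t == j then 1 else v * P)%N.
  have WS : W%:R \in legendre_class p e.
    rewrite (Fp_nat_eq_mod p_prime _ Wp) ?dvdn_exp // natrM.
    by rewrite -[e](addbK (c && odd (t - j))) legendre_classM.
  exists W; split => //.
    rewrite coprimeMl; apply/andP; split.
      rewrite coprimeXl // -Fp_nat_neq0 //; apply: contraTneq WS => ->.
      exact: legendre_class0.
    rewrite coprime_sym (eq_modn_coprime Wq); case: eqP => [//|/eqP tj].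
      by rewrite coprime1n.
    have tj0 : (0 < t - j)%N by rewrite subn_gt0 ltn_neqAle eq_sym tj.
    rewrite coprimeXr //; move: vQ; rewrite coprime_pexpr // => vq.
    by rewrite coprimeMl vq -[q]expn1 coprime_pq.
  apply/eqP; rewrite /f /= Zp_nat_eqE // [X in _ == _ %[mod X]]nE eqn_modM //.
  rewrite chinese_remainder // modnMDl addnC modnMDl.
  have -> : (W = u * Q %[mod P])%N by apply: eq_modn_dvd Wp; rewrite psE dvdn_mull.
  have -> : (W = if t == j then 1 else v * P %[mod Q])%N.
    by apply: eq_modn_dvd Wq; rewrite qtE dvdn_mull.
  rewrite eqxx /=.
  (* For [j = t] the modulus [Q] is 1, so the residue chosen for [W] mod [q ^ t] does not matter
     here. *)
  case: (t =P j) => [tj|_] /=; last by rewrite eqxx.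
  have modQ k : (k %% Q = 0)%N by rewrite /Q tj subnn expn0 modn1.
  by rewrite !modQ.
have expE k : 'qX ^+ ((k%:R : 'Z_n) : nat) = 'qX ^+ k :> cyclic_ring l n.
  by rewrite val_Zp_nat // expr_mod // qpolyX_order // ltnW.
rewrite /coset_sum f_im big_imset; last by move=> ? ? _ _; apply: f_inj.
rewrite /legendre_sum /coprime_sum !big_mkord mulr_suml.
under [RHS]eq_bigr do rewrite mulr_sumr.
rewrite pair_big /=; apply: eq_big => [[u v]|[u v] _]; first by rewrite inE.
rewrite /f expE /= -!exprM -exprD; congr (_ ^+ _).
by rewrite psE qtE /K; ring.
Qed.

End CyclotomicCosets.

(** * Squaring the factored sums and assembling the formulas *)

Lemma sum_product_square l p q s t i j b :
  prime p -> prime q -> (p %% 4 = 3)%N -> (i < s)%N -> (j < t)%N ->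
  let y := 'qX ^+ (q ^ t) : cyclic_ring l (p ^ s * q ^ t) in
  let z := 'qX ^+ (p ^ s) : cyclic_ring l (p ^ s * q ^ t) in
  let Y b := legendre_sum p b (y ^+ (p ^ i)) (s - i) in
  let B m := coprime_sum q (z ^+ (q ^ m)) (t - m) in
  (Y b * B j) ^+ 2
  = (p ^ (s - i - 1))%:R
    * (((p - 3) %/ 4)%:R * Y b + ((p + 1) %/ 4)%:R * Y (~~ b))
    * ((q ^ (t - j - 1))%:R * ((q - 2)%:R * B j
                               + (q.-1)%:R * \sum_(j.+1 <= m < t.+1) B m)).
Proof.
move=> p_prime q_prime p_mod4 lt_is lt_jt y z Y B.
have n_gt0 : (0 < p ^ s * q ^ t)%N by rewrite muln_gt0 !expn_gt0 !prime_gt0.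
rewrite exprMn /Y -(prednK (_ : 0 < s - i)%N) ?subn_gt0 // subn1.
rewrite legendre_sum_square //; last first.
  (* The base [y ^+ (p ^ i)] has order dividing [p ^ (s - i)], since [y ^+ (p ^ s)] is the [n]-th
     power of the class of X. *)
  by rewrite prednK ?subn_gt0 // /y -!exprM -mulnA -expnD subnKC ?(ltnW lt_is) //
             [(q ^ t * _)%N]mulnC qpolyX_order.
congr (_ * _); rewrite /B coprime_sum_telescope // -(prednK (_ : 0 < t - j)%N) ?subn_gt0 //.
rewrite subn1 coprime_sum_square //.
by rewrite prednK ?subn_gt0 // /z -!exprM -mulnA -expnD subnKC ?(ltnW lt_jt) // qpolyX_order.
Qed.

Lemma bilinear_expand (R : comNzRingType) (a a' c d e e' u u' v w : R) :
  c * (a * u + a' * u') * (d * (e * v + e' * w))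
  = a * c * (e * d * (u * v) + e' * d * (u * w))
    + a' * c * (e * d * (u' * v) + e' * d * (u' * w)).
Proof. by ring. Qed.

Lemma odd_sub_parity j m t : (j < m)%N -> (m <= t)%N ->
  odd (t - m) = (2 %| m - j)%N (+) ~~ odd (t - j).
Proof. by rewrite dvdn2; lia. Qed.

(** For [q] a nonresidue, the plain and starred sums alternate with the parity of [m - j] so that
    all share one factor [Y], the [c] here. *)
Lemma sum_merge (R : comNzRingType) (F F' B : nat -> R) (P : pred nat) (c : R) a b :
  (forall m, (a <= m < b)%N -> ~~ P m -> F m = c * B m) ->
  (forall m, (a <= m < b)%N -> P m -> F' m = c * B m) ->
  \sum_(a <= m < b | ~~ P m) F m + \sum_(a <= m < b | P m) F' m
  = c * \sum_(a <= m < b) B m.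
Proof.
move=> FE F'E; rewrite addrC mulr_sumr [RHS](bigID P) /=.
congr (_ + _); rewrite big_nat_cond [RHS]big_nat_cond; apply: eq_bigr => m /andP[mI].
  exact: F'E.
exact: FE.
Qed.

Lemma quad_residue_legendre p q :
  prime p -> (p %% 4 = 3)%N -> quad_residue p q -> q%:R \in legendre_class p false.
Proof.
move=> p_prime p_mod4 [qp [x xE]].
have E : q%:R = (x%:R : 'F_p) ^+ 2.
  by rewrite -natrX; apply/esym/(Fp_nat_eq_mod p_prime (dvdnn p)).
have x0 : (x%:R : 'F_p) != 0.
  have : (q%:R : 'F_p) != 0 by rewrite Fp_nat_neq0 // coprime_sym.
  by rewrite E expf_eq0.
rewrite inE E -exprM mulnC muln2 (_ : (_./2).*2 = p.-1)%N; last by lia.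
by rewrite Fp_expr_pred.
Qed.

Lemma quad_nonresidue_legendre p q :
  prime p -> (p %% 4 = 3)%N -> quad_nonresidue p q -> q%:R \in legendre_class p true.
Proof.
move=> p_prime p_mod4 [qp nsq].
have q0 : (q%:R : 'F_p) != 0 by rewrite Fp_nat_neq0 // coprime_sym.
have [[] // qS] := legendre_class_ex p_prime p_mod4 q0; case: nsq.
(* for [p = 3 mod 4], Euler's criterion makes [q ^ ((p + 1) / 4)] a square root *)
exists (q ^ ((p + 1) %/ 4))%N.
rewrite -!(val_Fp_nat p_prime) !natrX -exprM; congr (_ : nat).
have -> : ((p + 1) %/ 4 * 2 = p.-1./2 + 1)%N by lia.
by move: qS; rewrite inE exprD => /eqP->; rewrite mul1r.
Qed.

Lemma Zp_intr_absz_mod m n (g : int) : (1 < m)%N -> (m %| n)%N -> (0 < n)%N ->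
  g%:~R = (`|(g %% n)%Z|%N)%:R :> 'Z_m.
Proof.
move=> m_gt1 mn n_gt0; rewrite {1}(divz_eq g n) intrD intrM.
have -> : (n%:Z)%:~R = 0 :> 'Z_m.
  by apply/eqP; rewrite -[0]/(0%:R) Zp_nat_eqE // mod0n.
by rewrite mulr0 add0r -{1}(gez0_abs (modz_ge0 g _)) // eqz_nat -lt0n.
Qed.

Lemma primitive_root_coprime m g : (1 < m)%N ->
  primitive_root_mod m (g : nat) -> coprime m g.
Proof.
move=> m_gt1 prim_g; rewrite -unitZpE // -(unitrX_pos _ (prim_order_gt0 prim_g)).
by rewrite (prim_expr_order prim_g) unitr1.
Qed.

Theorem theorem4p2 (s t p q l : nat) (g : int) (i j : nat)
  (s_ge1 : (1 <= s)%N) (t_ge1 : (1 <= t)%N)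
  (p_prime : prime p) (q_prime : prime q) (l_prime : prime l)
  (pq_neq : p <> q) (pl_neq : p <> l) (ql_neq : q <> l)
  (p_odd : odd p) (q_odd : odd q)
  (p_mod4 : (p = 3 %[mod 4])%N)
  (ord_l_p : has_mult_order (p ^ s) l (totient (p ^ s) %/ 2))
  (ord_l_q : has_mult_order (q ^ t) l (totient (q ^ t)))
  (gcd_phi : gcdn (totient (p ^ s)) (totient (q ^ t)) = 2%N)
  (g_prim_p : primitive_root_mod (p ^ s) g)
  (g_prim_q : primitive_root_mod (q ^ t) g)
  (i_le : (i <= s - 1)%N) (j_le : (j <= t - 1)%N) :
  let X := chi l p q s t in
  let Xs := chi_star l p q s t g in
  (quad_residue p q ->
   Xs i j ^+ 2 =
     ((p - 3) %/ 4 * p ^ (s - i - 1))%N%:R *: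
       (((q - 2) * q ^ (t - j - 1))%N%:R *: Xs i j
        + (totient (q ^ (t - j)))%:R *: \sum_(j.+1 <= m < t.+1) Xs i m)
     + ((p + 1) %/ 4 * p ^ (s - i - 1))%N%:R *:
       (((q - 2) * q ^ (t - j - 1))%N%:R *: X i j
        + (totient (q ^ (t - j)))%:R *: \sum_(j.+1 <= m < t.+1) X i m))
  /\
  (quad_nonresidue p q ->
   Xs i j ^+ 2 =
     ((p - 3) %/ 4 * p ^ (s - i - 1))%N%:R *:
       (((q - 2) * q ^ (t - j - 1))%N%:R *: Xs i j
        + (totient (q ^ (t - j)))%:R *:
          (\sum_(j.+1 <= m < t.+1 | ~~ (2 %| m - j)%N) X i m
           + \sum_(j.+1 <= m < t.+1 | (2 %| m - j)%N) Xs i m))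
     + ((p + 1) %/ 4 * p ^ (s - i - 1))%N%:R *:
       (((q - 2) * q ^ (t - j - 1))%N%:R *: X i j
        + (totient (q ^ (t - j)))%:R *:
          (\sum_(j.+1 <= m < t.+1 | ~~ (2 %| m - j)%N) Xs i m
           + \sum_(j.+1 <= m < t.+1 | (2 %| m - j)%N) X i m))).
Proof.
have p4 : (p %% 4 = 3)%N by rewrite p_mod4.
have lt_is : (i < s)%N by rewrite -(prednK s_ge1) ltnS -subn1.
have lt_jt : (j < t)%N by rewrite -(prednK t_ge1) ltnS -subn1.
set n := (p ^ s * q ^ t)%N.
have ps1 := prime_power_gt1 p_prime s_ge1; have qt1 := prime_power_gt1 q_prime t_ge1.
have n_gt1 : (1 < n)%N by apply: leq_trans ps1 _; rewrite leq_pmulr // ltnW.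
(* One natural representative of [g] serves modulo [p ^ s], [q ^ t] and [n], as all three divide
   [n]. *)
pose G := `|(g %% n)%Z|%N.
have gE m : (1 < m)%N -> (m %| n)%N -> g%:~R = G%:R :> 'Z_m.
  by move=> m_gt1 mn; apply: Zp_intr_absz_mod => //; apply: ltnW.
have prim_p : primitive_root_mod (p ^ s) G.
  by move: g_prim_p; rewrite /primitive_root_mod /has_mult_order gE // dvdn_mulr.
have prim_q : primitive_root_mod (q ^ t) G.
  by move: g_prim_q; rewrite /primitive_root_mod /has_mult_order gE // dvdn_mull.
have psG := primitive_root_coprime ps1 prim_p.
have nG : coprime n G.
  by rewrite coprimeMl psG (primitive_root_coprime qt1).
have GS : G%:R \in legendre_class p true.
  have pps : (p %| p ^ s)%N by rewrite dvdn_exp.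
  have G0 : (G%:R : 'F_p) != 0 by rewrite Fp_nat_neq0 // (coprime_dvdl pps).
  have [b bS] := legendre_class_ex p_prime p4 G0.
  by rewrite -(prim_root_unit_class p_prime p4 pps ps1 psG prim_p bS).
move=> X Xs.
pose Y b := legendre_sum p b (('qX ^+ (q ^ t) : cyclic_ring l n) ^+ (p ^ i)) (s - i).
pose B m := coprime_sum q (('qX ^+ (p ^ s) : cyclic_ring l n) ^+ (q ^ m)) (t - m).
have factor := coset_sum_factor p_prime q_prime l_prime pq_neq pl_neq ql_neq
  p4 s_ge1 t_ge1 ord_l_p ord_l_q gcd_phi.
(* The flag [c] is true when [q] is a nonresidue; [G = 1] is a square, so only the character of
   [q ^ (t - m)] remains. *)
have XE c m : q%:R \in legendre_class p c -> (m <= t)%N ->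
  X i m = Y (c && odd (t - m)) * B m.
  move=> qS le_mt; apply: (factor c i m false 1%N) => //; first by rewrite coprimen1.
    by rewrite inE expr1n expr0.
  by rewrite muln1.
have XsE c m : q%:R \in legendre_class p c -> (m <= t)%N ->
  Xs i m = Y (~~ (c && odd (t - m))) * B m.
  move=> qS le_mt; apply: (factor c i m true G) => //.
  by rewrite intrM gE // natrM.
have totE : totient (q ^ (t - j)) = (q.-1 * q ^ (t - j - 1))%N.
  by rewrite totient_pfactor ?subn_gt0 // subn1.
have square b := @sum_product_square l p q s t i j b p_prime q_prime p4 lt_is lt_jt.
have scaleE k (x : cyclic_ring l n) : (k%:R : 'F_l) *: x = k%:R * x.
  by rewrite scaler_nat mulr_natl.
split.
  move/(quad_residue_legendre p_prime p4) => qS.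
  have -> : \sum_(j.+1 <= m < t.+1) Xs i m = Y true * \sum_(j.+1 <= m < t.+1) B m.
    rewrite mulr_sumr; apply: eq_big_nat => m /andP[_ le_mt]; exact: XsE qS _.
  have -> : \sum_(j.+1 <= m < t.+1) X i m = Y false * \sum_(j.+1 <= m < t.+1) B m.
    rewrite mulr_sumr; apply: eq_big_nat => m /andP[_ le_mt]; exact: XE qS _.
  rewrite (XsE _ _ qS (ltnW lt_jt)) (XE _ _ qS (ltnW lt_jt)) /= [LHS]square totE.
  rewrite !scaleE !natrM; apply: bilinear_expand.
move/(quad_nonresidue_legendre p_prime p4) => qS.
(* The class for which [Xs i j = Y b * B j]; the class at index [m] is compared with it through the
   parity of [m - j]. *)
pose b := ~~ odd (t - j).
have parity m : (j.+1 <= m < t.+1)%N -> odd (t - m) = (2 %| m - j)%N (+) b.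
  by move=> /andP[lt_jm le_mt]; apply: odd_sub_parity.
have -> : \sum_(j.+1 <= m < t.+1 | ~~ (2 %| m - j)%N) X i m
  + \sum_(j.+1 <= m < t.+1 | (2 %| m - j)%N) Xs i m
  = Y b * \sum_(j.+1 <= m < t.+1) B m.
  apply: sum_merge => m mI; have /andP[_ le_mt] := mI => h2.
    by rewrite (XE _ _ qS le_mt) /= parity // (negPf h2).
  by rewrite (XsE _ _ qS le_mt) /= parity // h2 negbK.
have -> : \sum_(j.+1 <= m < t.+1 | ~~ (2 %| m - j)%N) Xs i m
  + \sum_(j.+1 <= m < t.+1 | (2 %| m - j)%N) X i m
  = Y (~~ b) * \sum_(j.+1 <= m < t.+1) B m.
  apply: sum_merge => m mI; have /andP[_ le_mt] := mI => h2.
    by rewrite (XsE _ _ qS le_mt) /= parity // (negPf h2).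
  by rewrite (XE _ _ qS le_mt) /= parity // h2.
rewrite (XsE _ _ qS (ltnW lt_jt)) (XE _ _ qS (ltnW lt_jt)) /= [LHS]square totE.
rewrite /b negbK.
rewrite !scaleE !natrM; apply: bilinear_expand.
Qed.
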